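(* Let $G<\mathbb{C}^\times\times\mathbb{C}^\times<\mathrm{GL}_2(\mathbb{C})<\mathrm{Sp}_4(\mathbb{C})$ be a finite group of diagonal matrices and $V=\mathbb{C}^4$. Let $\Gamma$ be the graph and $\mathcal{C}$ the set of connected components of $\Gamma$ defined in the context. Pick for each $C\in\mathcal{C}$ a vertex $(a_C,b_C)\in C$. Then a basis of $\mathsf{HP}_0(\mathcal{O}_V^G,\mathcal{O}_V)$ is given by the images of the monomials $\{x_1^{a_C}x_2^{b_C}y_1^{a_C}y_2^{b_C}\mid C\in\mathcal{C}\}$.
   Context: $V=X\oplus Y$ with $X=\mathbb{C}^2$, $Y=X^*$, and $\mathrm{GL}_2(\mathbb{C})=\mathrm{GL}(X)<\mathrm{Sp}(V)$ via $M\mapsto M\oplus(M^{-1})^*$. $\mathcal{O}_V=\mathbb{C}[x_1,x_2,y_1,y_2]$ with $\{x_i,y_j\}=\delta_{ij}$, $\{x_i,x_j\}=\{y_i,y_j\}=0$, where $x_1,x_2$ are the standard coordinates on $X$ and $y_1,y_2$ the dual coordinates on $Y$ (so if $\mathrm{diag}(\zeta,\xi)$ scales $x_1,x_2$ by $\alpha,\beta$ it scales $y_1,y_2$ by $\alpha^{-1},\beta^{-1}$). $\mathsf{HP}_0(\mathcal{O}_V^G,\mathcal{O}_V):=\mathcal{O}_V/\{\mathcal{O}_V^G,\mathcal{O}_V\}$ (quotient by the linear span of brackets). Let $V_1$ be the minimal set of generators of the multiplicative semigroup $\{x_1^rx_2^s\in\mathcal{O}_V^G : r,s\ge0,\ (r,s)\ne(0,0)\}$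 and $V_2$ the minimal set of generators of the semigroup $\{x_1^ry_2^s\in\mathcal{O}_V^G : r,s\ge0,\ (r,s)\ne(0,0)\}$. $\Gamma$ is the graph (multiple edges allowed) whose vertices are the points $(j,k)\in\mathbb{Z}^2$ with $j,k\ge-1$, and whose edges are as follows: for each $(r,s)$ with $x_1^rx_2^s\in V_1$ and every pair of nonnegative integers $a,b$, one edge between $(a+r,b+s-1)$ and $(a+r-1,b+s)$; and then likewise, for each $(r,s)$ with $x_1^ry_2^s\in V_2$ and every pair of nonnegative integers $a,b$, one edge between $(a+r,b+s-1)$ and $(a+r-1,b+s)$. $\mathcal{C}$ is the set of connected components of $\Gamma$ all of whose vertices are pairs of nonnegative integers, and such that every pair of adjacent vertices comprises the endpoints of a unique edge (i.e. there are no multiple edges in the component). *)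

(* Defs.v *)
From HB Require Import structures.
From Stdlib Require Import Relations.
From mathcomp Require Import all_boot all_order all_algebra.
From mathcomp Require Import finmap.
From mathcomp Require Import complex.
From mathcomp Require Import boolp classical_sets reals.
From mathcomp.multinomials Require Import mpoly.

Set Implicit Arguments.
Unset Strict Implicit.
Unset Printing Implicit Defensive.

Import Order.TTheory GRing.Theory Num.Theory.
Local Open Scope classical_set_scope.
Local Open Scope ring_scope.
Local Open Scope quotient_scope.

Section LinearAlgebra.
Variables (K : fieldType) (M : lmodType K).

Definition linear_span (A : set M) : set M :=
  [set m | exists2 s : seq (K * M),
     (forall p, p \in s -> A p.2) & m = \sum_(p <- s) p.1 *: p.2].

Definition span_pred (A : set M) : {pred M} := fun m => `[< linear_span A m >].

Lemma span_pred_submod_closed (A : set M) : submod_closed (span_pred A).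
Proof.
split=> [|a u v /asboolP[s sA ->] /asboolP[t tA ->]].
  by apply/asboolP; exists [::]; rewrite ?big_nil.
apply/asboolP; exists ([seq (a * p.1, p.2) | p <- s] ++ t) => [p|].
  by rewrite mem_cat => /orP[/mapP[q /sA Aq ->]|/tA].
rewrite big_cat big_map scaler_sumr /=; congr (_ + _).
by apply: eq_bigr => p _; rewrite scalerA.
Qed.

HB.instance Definition _ (A : set M) :=
  GRing.isSubmodClosed.Build K M (span_pred A) (span_pred_submod_closed A).

Definition quot_span (A : set M) := Quotient.quot (span_pred A).

HB.instance Definition _ (A : set M) := GRing.Zmodule.on (quot_span A).

Section QuotientScaling.
Variable A : set M.

Definition quot_class (m : M) : quot_span A := \pi_(Quotient.quot (span_pred A)) m.

Definition quot_scale (a : K) (q : quot_span A) : quot_span A :=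
  quot_class (a *: repr q).

Lemma quot_classP (m n : M) :
  reflect (quot_class m = quot_class n) (m - n \in span_pred A).
Proof. by rewrite Quotient.idealrBE; apply: eqP. Qed.

Lemma quot_classK (q : quot_span A) : quot_class (repr q) = q.
Proof. exact: reprK. Qed.

Lemma quot_classD (m n : M) : quot_class (m + n) = quot_class m + quot_class n.
Proof. exact: raddfD. Qed.

Lemma quot_class_scale a m : quot_scale a (quot_class m) = quot_class (a *: m).
Proof.
apply/quot_classP; rewrite -scalerBr rpredZ //.
by apply/quot_classP; rewrite quot_classK.
Qed.

Lemma quot_scaleA a b q :
  quot_scale a (quot_scale b q) = quot_scale (a * b) q.
Proof. by rewrite -[q]quot_classK !quot_class_scale scalerA. Qed.

Lemma quot_scale1 : left_id 1 quot_scale.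
Proof. by move=> q; rewrite -[q]quot_classK quot_class_scale scale1r. Qed.

Lemma quot_scaleDr : right_distributive quot_scale +%R.
Proof.
move=> a q r; rewrite -[q]quot_classK -[r]quot_classK.
by rewrite -quot_classD !quot_class_scale scalerDr quot_classD.
Qed.

Lemma quot_scaleDl q : {morph quot_scale^~ q : a b / a + b}.
Proof.
move=> a b; rewrite -[q]quot_classK !quot_class_scale.
by rewrite scalerDl quot_classD.
Qed.

HB.instance Definition _ := GRing.Zmodule_isLmodule.Build K (quot_span A)
  quot_scaleA quot_scale1 quot_scaleDr quot_scaleDl.

End QuotientScaling.

Definition is_basis (I : choiceType) (v : I -> M) : Prop :=
  (forall (J : {fset I}) (c : I -> K),
     \sum_(i <- J) c i *: v i = 0 -> forall i, i \in J -> c i = 0) /\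
  (forall m : M, exists (J : {fset I}) (c : I -> K),
     m = \sum_(i <- J) c i *: v i).

End LinearAlgebra.

Section PoissonHomology.
Variable R : realType.
Local Notation C := R[i].

(* The coordinate ring of V = X (+) X^*: the variables of index 0, 1 are the
   coordinates x_1, x_2 on X, and those of index 2, 3 the dual coordinates
   y_1, y_2 on Y = X^*. *)
Definition OV := {mpoly C[2 + 2]}.

Definition x1 : OV := 'X_(lshift 2 (0 : 'I_2)).
Definition x2 : OV := 'X_(lshift 2 (1 : 'I_2)).
Definition y1 : OV := 'X_(rshift 2 (0 : 'I_2)).
Definition y2 : OV := 'X_(rshift 2 (1 : 'I_2)).

Definition poisson (f g : OV) : OV :=
  \sum_(i < 2) (mderiv (lshift 2 i) f * mderiv (rshift 2 i) g
              - mderiv (rshift 2 i) f * mderiv (lshift 2 i) g).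

Definition is_finite_subgroup_GL (n : nat) (G : {fset 'M[C]_n}) : Prop :=
  [/\ {in G, forall g, g \in unitmx},
      1%:M \in G,
      {in G &, forall g h, g *m h \in G}
    & {in G, forall g, invmx g \in G}].

(* M |-> M (+) (M^-1)^*; in the dual coordinates the adjoint is the transpose. *)
Definition sp_of_gl (g : 'M[C]_2) : 'M[C]_(2 + 2) :=
  block_mx g 0 0 (invmx g)^T.

(* The function v |-> f (A v). *)
Definition precomp (A : 'M[C]_(2 + 2)) (f : OV) : OV :=
  f \mPo [tuple \sum_j A i j *: 'X_j | i < 2 + 2].

(* As G is closed under inverses, g and g^-1 give the same condition here. *)
Definition invariants (G : {fset 'M[C]_2}) : set OV :=
  [set f | forall g, g \in G -> precomp (sp_of_gl g) f = f].

Definition brackets (A : set OV) : set OV :=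
  [set h | exists f g, A f /\ h = poisson f g].

Definition HP0 (A : set OV) := quot_span (brackets A).

HB.instance Definition _ (A : set OV) := GRing.Lmodule.on (HP0 A).

Definition HP0_class (A : set OV) (f : OV) : HP0 A := quot_class (brackets A) f.

Definition mul_closed (S : set OV) : Prop :=
  forall f g, S f -> S g -> S (f * g).

(* The nonempty products of elements of W. *)
Definition generated_semigroup (W : set OV) : set OV := smallest mul_closed W.

Definition minimal_generators (S W : set OV) : Prop :=
  generated_semigroup W = S /\
  (forall W' : set OV, W' `<=` W -> generated_semigroup W' = S -> W' = W).

Definition invariant_monomials (G : {fset 'M[C]_2}) (u v : OV) : set OV :=
  [set f | exists r s : nat,
     [/\ (r, s) <> (0%N, 0%N), f = u ^+ r * v ^+ s & invariants G f]].

Definition exponents (u v : OV) (W : set OV) : set (nat * nat) :=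
  [set rs | W (u ^+ rs.1 * v ^+ rs.2)].

End PoissonHomology.

Arguments x1 {R}.
Arguments x2 {R}.
Arguments y1 {R}.
Arguments y2 {R}.

Record multigraph := Multigraph {
  vertex : Type;
  edge : Type;
  ends : edge -> vertex * vertex
}.

Section Multigraph.
Variable Gr : multigraph.

Definition joins (e : edge Gr) (u v : vertex Gr) : Prop :=
  ends e = (u, v) \/ ends e = (v, u).

Definition adjacent (u v : vertex Gr) : Prop := exists e, joins e u v.

Definition component (u : vertex Gr) : set (vertex Gr) :=
  [set v | clos_refl_trans _ adjacent u v].

Definition components : set (set (vertex Gr)) := range component.

Definition no_multiple_edges (D : set (vertex Gr)) : Prop :=
  forall u v, D u -> D v -> adjacent u v -> exists! e, joins e u v.

End Multigraph.

Definition lattice_point := {p : int * int | (-1 <= p.1) && (-1 <= p.2)}.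

Lemma left_end_subproof (p q : nat) :
  (-1 <= (p%:Z, q%:Z - 1).1) && (-1 <= (p%:Z, q%:Z - 1).2).
Proof. by rewrite /= lerBrDr addNr lez_nat. Qed.

Lemma right_end_subproof (p q : nat) :
  (-1 <= (p%:Z - 1, q%:Z).1) && (-1 <= (p%:Z - 1, q%:Z).2).
Proof. by rewrite andbC left_end_subproof. Qed.

Definition left_end (p q : nat) : lattice_point :=
  exist _ (p%:Z, q%:Z - 1) (left_end_subproof p q).

Definition right_end (p q : nat) : lattice_point :=
  exist _ (p%:Z - 1, q%:Z) (right_end_subproof p q).

Section Gamma.
Variables (R : realType) (V1 V2 : set (OV R)).

(* An edge is ((r, s), (a, b)), tagged by whether (r, s) comes from V1 or V2,
   so that the two families never share an edge. *)
Definition gamma_edge : Type :=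
  (exponents x1 x2 V1 * (nat * nat)) + (exponents x1 y2 V2 * (nat * nat)).

Definition gamma_ends (e : gamma_edge) : lattice_point * lattice_point :=
  let: ((r, s), (a, b)) :=
    match e with inl e1 => (val e1.1, e1.2) | inr e2 => (val e2.1, e2.2) end in
  (left_end (a + r) (b + s), right_end (a + r) (b + s)).

Definition Gamma : multigraph := Multigraph gamma_ends.

Definition simple_components : set (set lattice_point) :=
  [set D | [/\ components (Gr := Gamma) D,
               forall v, D v -> (0 <= (val v).1) && (0 <= (val v).2)
             & no_multiple_edges (Gr := Gamma) D]].

End Gamma.

(* Only used at points with nonnegative coordinates, where the absolute values
   are the coordinates themselves. *)
Definition vertex_monomial (R : realType) (v : lattice_point) : OV R :=
  let a := `|(val v).1|%N in let b := `|(val v).2|%N in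
  x1 ^+ a * x2 ^+ b * y1 ^+ a * y2 ^+ b.

(* Main.v *)
(* Bracketing with the invariants x1 y1 and x2 y2 kills every monomial of nonzero
   torus weight, so HP0 is spanned by the u^j v^k with u = x1 y1, v = x2 y2.  Put
   e(j,k) = u^j v^k / (j! k!), and e = 0 when a coordinate is -1.  Bracketing an
   invariant monomial of weight (a, b) with a monomial of weight (-a, -b) gives
   a e(p-1,q) + b e(p,q-1) = 0 whenever |a| <= p and |b| <= q.  These relations
   are additive in (a, b), so the minimal generators suffice: each edge of the
   graph is one relation between the values of e at its ends.

   Generators on a coordinate axis lie in both V1 and V2, so they give double
   edges, and they kill both ends.  Any other edge makes its ends nonzero
   multiples of each other, and two such edges with the same ends give
   independent relations, because minimal generators in one quadrant are
   incomparable.  Hence e vanishes on the components outside C and spans at most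
   a line on those in C.  Conversely a component in C is a path with one relation
   per edge, and the product of the ratios along the path defines a functional
   that vanishes on all brackets and on no vertex of the component. *)

Require Import Defs.
From Stdlib Require Import Relations.
From mathcomp Require Import all_boot all_order all_algebra.
From mathcomp Require Import finmap.
From mathcomp Require Import complex.
From mathcomp Require Import boolp classical_sets reals.
From mathcomp.multinomials Require Import ssrcomplements mpoly.
From mathcomp Require Import zify ring.

Set Implicit Arguments.
Unset Strict Implicit.
Unset Printing Implicit Defensive.

Import Order.TTheory GRing.Theory Num.Theory.
Local Open Scope classical_set_scope.
Local Open Scope ring_scope.

(** * Brackets of monomials *)

Local Notation ix1 := (lshift 2 (0 : 'I_2)).
Local Notation ix2 := (lshift 2 (1 : 'I_2)).
Local Notation iy1 := (rshift 2 (0 : 'I_2)).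
Local Notation iy2 := (rshift 2 (1 : 'I_2)).

Definition mon4 (a b c d : nat) : 'X_{1..2 + 2} :=
  [multinom nth 0%N [:: a; b; c; d] i | i < 2 + 2].

Lemma ord4P (P : 'I_(2 + 2) -> Prop) :
  P ix1 -> P ix2 -> P iy1 -> P iy2 -> forall i, P i.
Proof.
move=> P1 P2 P3 P4; case=> [[|[|[|[|//]]]] lt_i4].
- by rewrite (_ : Ordinal _ = ix1) //; apply/val_inj.
- by rewrite (_ : Ordinal _ = ix2) //; apply/val_inj.
- by rewrite (_ : Ordinal _ = iy1) //; apply/val_inj.
- by rewrite (_ : Ordinal _ = iy2) //; apply/val_inj.
Qed.

Lemma mon4E a b c d :
  (mon4 a b c d ix1 = a) * (mon4 a b c d ix2 = b) *
  (mon4 a b c d iy1 = c) * (mon4 a b c d iy2 = d).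
Proof. by rewrite !mnmE. Qed.

Lemma mon4P (m1 m2 : 'X_{1..2 + 2}) :
  m1 ix1 = m2 ix1 -> m1 ix2 = m2 ix2 -> m1 iy1 = m2 iy1 -> m1 iy2 = m2 iy2 ->
  m1 = m2.
Proof. by move=> e1 e2 e3 e4; apply/mnmP; apply: ord4P. Qed.

Lemma mon4K (m : 'X_{1..2 + 2}) : m = mon4 (m ix1) (m ix2) (m iy1) (m iy2).
Proof. by apply: mon4P; rewrite mon4E. Qed.

Definition balanced (m : 'X_{1..2 + 2}) : bool :=
  (m ix1 == m iy1) && (m ix2 == m iy2).

Lemma nat_point_subproof (j k : nat) :
  (-1 <= (j%:Z, k%:Z).1) && (-1 <= (j%:Z, k%:Z).2).
Proof. rewrite /=; lia. Qed.

Definition nat_point (j k : nat) : lattice_point :=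
  exist _ (j%:Z, k%:Z) (nat_point_subproof j k).

Definition nonneg_pt (v : lattice_point) : bool :=
  (0 <= (val v).1) && (0 <= (val v).2).

Lemma nonneg_ptP v : nonneg_pt v -> exists j k, v = nat_point j k.
Proof.
rewrite /nonneg_pt; case: v => [[j k] jk] /andP[/= j_ge0 k_ge0].
exists `|j|%N, `|k|%N; apply/val_inj => /=; congr (_, _); lia.
Qed.

Lemma right_endS p q : right_end p.+1 q = nat_point p q.
Proof. by apply/val_inj; rewrite /=; congr (_, _); lia. Qed.

Lemma left_endS p q : left_end p q.+1 = nat_point p q.
Proof. by apply/val_inj; rewrite /=; congr (_, _); lia. Qed.

Lemma nonneg_right p q : nonneg_pt (right_end p q) = (0 < p)%N.
Proof. rewrite /nonneg_pt /=; lia. Qed.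

Lemma nonneg_left p q : nonneg_pt (left_end p q) = (0 < q)%N.
Proof. rewrite /nonneg_pt /=; lia. Qed.

Section MonomialBrackets.
Variable K : comNzRingType.
Local Notation P := {mpoly K[2 + 2]}.

Lemma mpolyX_inj (m m' : 'X_{1..2 + 2}) : 'X_[m] = 'X_[m'] :> P -> m = m'.
Proof.
move=> /(congr1 (mcoeff m)); rewrite !mcoeffX eqxx.
by case: eqP => // _ /eqP; rewrite oner_eq0.
Qed.

Lemma mderivX_mul (i j : 'I_(2 + 2)) (m m' : 'X_{1..2 + 2}) : i != j ->
  mderiv i 'X_[m] * mderiv j 'X_[m'] =
    (m i * m' j)%:R *: 'X_[m + m' - U_(i) - U_(j)] :> P.
Proof.
move=> neq_ij; rewrite !mderivX -scalerAl -scalerAr scalerA -natrM -mpolyXD.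
(* Subtraction of exponents is truncated; wherever truncation could matter, the coefficient is
   zero. *)
have [->|mi_gt0] := posnP (m i); first by rewrite mul0n !scale0r.
have [->|mj_gt0] := posnP (m' j); first by rewrite muln0 !scale0r.
congr (_ *: 'X_[_]); apply/mnmP => k.
rewrite !(mnmBE, mnmDE) !mnm1E.
case: (eqVneq i k) neq_ij mi_gt0 => [<-|_].
  by rewrite eq_sym => /negbTE -> ? /=; lia.
case: (eqVneq j k) mj_gt0 => [<-|_] ? _ ? /=; lia.
Qed.

Lemma mderivX_bracket (i j : 'I_(2 + 2)) (m m' : 'X_{1..2 + 2}) : i != j ->
  mderiv i 'X_[m] * mderiv j 'X_[m'] - mderiv j 'X_[m] * mderiv i 'X_[m'] =
    ((m i * m' j)%:R - (m j * m' i)%:R) *: 'X_[m + m' - U_(i) - U_(j)] :> P.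
Proof.
have neq_sym : (i != j) = (j != i) by rewrite eq_sym.
move=> neq_ij; rewrite !mderivX_mul -?neq_sym // scalerBl.
congr (_ - _ *: 'X_[_]).
by apply/mnmP => k; rewrite !(mnmBE, mnmDE) subnAC.
Qed.

Lemma mderiv_bracket_linearl i j (g : P) : linear (fun f : P =>
  mderiv i f * mderiv j g - mderiv j f * mderiv i g).
Proof.
move=> c f f'; rewrite !linearP /= !mulrDl -!scalerAl scalerBr.
by rewrite opprD addrACA.
Qed.

Lemma mderiv_bracket_linearr i j (f : P) : linear (fun g : P =>
  mderiv i f * mderiv j g - mderiv j f * mderiv i g).
Proof.
move=> c g g'; rewrite !linearP /= !mulrDr -!scalerAr scalerBr.
by rewrite opprD addrACA.
Qed.

Lemma linear0_eq (M N : lmodType K) (F : M -> N) : linear F -> F 0 = 0.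
Proof. by move=> /(_ (-1) 0 0); rewrite !scaleN1r oppr0 addr0 addNr. Qed.

Lemma linear_scale (M N : lmodType K) (F : M -> N) c m :
  linear F -> F (c *: m) = c *: F m.
Proof. by move=> Flin; rewrite -[c *: m]addr0 Flin linear0_eq // addr0. Qed.

Lemma linear_mpoly_sum (M : lmodType K) (F : P -> M) (f : P) : linear F ->
  F f = \sum_(m <- msupp f) f@_m *: F 'X_[m].
Proof.
move=> Flin; rewrite {1}[f]mpolyE.
elim: (msupp f) => [|m s IHs]; first by rewrite !big_nil linear0_eq.
by rewrite !big_cons Flin IHs.
Qed.

Lemma sum_ord2 (V : nmodType) (F : 'I_2 -> V) : \sum_(i < 2) F i = F 0 + F 1.
Proof. by rewrite big_ord_recl big_ord1; congr (_ + F _); apply/val_inj. Qed.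

Lemma mpolyX_mon4_var a b c d : 'X_[mon4 a b c d] =
  'X_ix1 ^+ a * 'X_ix2 ^+ b * 'X_iy1 ^+ c * 'X_iy2 ^+ d :> P.
Proof.
rewrite mpolyXE_id big_split_ord !big_ord_recl !big_ord0 /= !mulr1.
by rewrite (_ : lift _ _ = 1) ?mon4E ?mulrA //; apply/val_inj.
Qed.

(** Used when the product of two monomials has the same exponent [n] in x_i and y_i: the coefficient
    of their bracket is then the weight of the first monomial times [n]. *)
Lemma natr_cross (a a' c c' n : nat) : a + a' = n -> c + c' = n ->
  (a * c')%:R - (c * a')%:R = (a%:R - c%:R) * n%:R :> K.
Proof. by move=> <- e; rewrite mulrBl -!natrM -{1}e !mulnDr !natrD mulnC; ring. Qed.

Lemma natr_factSl (c : K) p q :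
  c * p.+1%:R * (p`! * q`!)%:R = (p.+1`! * q`!)%:R * c.
Proof. by rewrite factS !natrM; ring. Qed.

Lemma natr_factSr (c : K) p q :
  c * q.+1%:R * (p`! * q`!)%:R = (p`! * q.+1`!)%:R * c.
Proof. by rewrite factS !natrM; ring. Qed.

End MonomialBrackets.

Section Algebra.
Variable R : realType.
Local Notation K := R[i].
Local Notation OV := (OV R).

Lemma mpolyX_mon4 a b c d :
  'X_[mon4 a b c d] = x1 ^+ a * x2 ^+ b * y1 ^+ c * y2 ^+ d :> OV.
Proof. exact: mpolyX_mon4_var. Qed.

Lemma poissonX (m m' : 'X_{1..2 + 2}) :
  poisson ('X_[m] : OV) 'X_[m'] =
    ((m ix1 * m' iy1)%:R - (m iy1 * m' ix1)%:R)
      *: 'X_[m + m' - U_(ix1) - U_(iy1)]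
  + ((m ix2 * m' iy2)%:R - (m iy2 * m' ix2)%:R)
      *: 'X_[m + m' - U_(ix2) - U_(iy2)].
Proof.
by apply: etrans (sum_ord2 _) _; congr (_ + _); apply: mderivX_bracket.
Qed.

Lemma poisson_linearl (g : OV) : linear (fun f : OV => poisson f g).
Proof.
move=> c f f'; rewrite /poisson scaler_sumr -big_split /=.
by apply: eq_bigr => i _; apply: mderiv_bracket_linearl.
Qed.

Lemma poisson_linearr (f : OV) : linear (fun g : OV => poisson f g).
Proof.
move=> c g g'; rewrite /poisson scaler_sumr -big_split /=.
by apply: eq_bigr => i _; apply: mderiv_bracket_linearr.
Qed.

(** This is e(j,k), with an arbitrary [F] in place of the class map, so that one computation serves
    both the quotient map and the functionals. The factorials absorb the factors p and q produced by
    differentiation, which makes the coefficients of the relations independent of the position. *)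
Definition scaled_class (M : lmodType K) (F : OV -> M) (v : lattice_point) : M :=
  if nonneg_pt v then
    (`|(val v).1|%N`! * `|(val v).2|%N`!)%:R^-1 *: F (vertex_monomial R v)
  else 0.

Lemma vertex_monomialE j k : vertex_monomial R (nat_point j k) = 'X_[mon4 j k j k].
Proof. by rewrite mpolyX_mon4. Qed.

Lemma scaled_classE (M : lmodType K) (F : OV -> M) j k :
  scaled_class F (nat_point j k) = (j`! * k`!)%:R^-1 *: F 'X_[mon4 j k j k].
Proof. by rewrite -vertex_monomialE. Qed.

Lemma fact_neq0 p q : (p`! * q`!)%:R != 0 :> K.
Proof. by rewrite pnatr_eq0 muln_eq0 negb_or -!lt0n !fact_gt0. Qed.

Lemma class_scaled (M : lmodType K) (F : OV -> M) j k :
  F 'X_[mon4 j k j k] = (j`! * k`!)%:R *: scaled_class F (nat_point j k).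
Proof. by rewrite scaled_classE scalerA divff ?scale1r // fact_neq0. Qed.

(* With u = x1 y1 and v = x2 y2, the two terms of the bracket of monomials of
   opposite weights are multiples of u^(p-1) v^q and u^p v^(q-1). *)
Lemma poisson_scaled_class (M : lmodType K) (F : OV -> M)
    (m m' : 'X_{1..2 + 2}) p q :
  linear F -> (m + m')%MM = mon4 p q p q ->
  F (poisson ('X_[m] : OV) 'X_[m']) = (p`! * q`!)%:R *:
    (((m ix1)%:R - (m iy1)%:R) *: scaled_class F (right_end p q)
     + ((m ix2)%:R - (m iy2)%:R) *: scaled_class F (left_end p q)).
Proof.
move=> Flin mm'.
have E i : m i + m' i = mon4 p q p q i by rewrite -mm' mnmDE.
have e1 : (m ix1 * m' iy1)%:R - (m iy1 * m' ix1)%:R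
    = ((m ix1)%:R - (m iy1)%:R) * p%:R :> K.
  by apply: natr_cross; rewrite E mon4E.
have e2 : (m ix2 * m' iy2)%:R - (m iy2 * m' ix2)%:R
    = ((m ix2)%:R - (m iy2)%:R) * q%:R :> K.
  by apply: natr_cross; rewrite E mon4E.
rewrite poissonX Flin (linear_scale _ _ Flin) mm' {}e1 {}e2 scalerDr.
congr (_ + _); rewrite scalerA.
(* For [p = 0] the coefficient vanishes, and so does e at the right end, whose first coordinate is
   -1. *)
- case: p {E mm'} => [|p].
    by rewrite mulr0 scale0r /scaled_class nonneg_right !scaler0.
  have -> : (mon4 p.+1 q p.+1 q - U_(ix1) - U_(iy1))%MM = mon4 p q p q.
    by apply: mon4P; rewrite !(mnmBE, mnm1E) !mon4E /= ?subn0 ?subn1.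
  by rewrite right_endS class_scaled scalerA natr_factSl.
case: q {E mm'} => [|q].
  by rewrite mulr0 scale0r /scaled_class nonneg_left !scaler0.
have -> : (mon4 p q.+1 p q.+1 - U_(ix2) - U_(iy2))%MM = mon4 p q p q.
  by apply: mon4P; rewrite !(mnmBE, mnm1E) !mon4E /= ?subn0 ?subn1.
by rewrite left_endS class_scaled scalerA natr_factSr.
Qed.

End Algebra.

(** * Minimal generators *)

Definition pair_add (a b : nat * nat) : nat * nat := (a.1 + b.1, a.2 + b.2)%N.

Definition atom (E : set (nat * nat)) (rs : nat * nat) : Prop :=
  E rs /\ forall a b, E a -> E b -> rs <> pair_add a b.

(** Strong induction on the coordinate sum: as [E] omits the origin, both summands of a reducible
    element have a smaller sum. *)
Lemma atom_ind (E P : set (nat * nat)) :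
  ~ E (0, 0)%N -> (forall a, atom E a -> P a) ->
  (forall a b, P a -> P b -> P (pair_add a b)) -> E `<=` P.
Proof.
move=> E0 Patom Padd a.
have [n] := ubnP (a.1 + a.2)%N; elim: n a => // n IHn a lt_an Ea.
have [|not_atom] := pselect (atom E a); first exact: Patom.
have [b [c [Eb Ec aE]]] : exists b c, [/\ E b, E c & a = pair_add b c].
  apply: contrapT => no_sum; apply: not_atom; split=> // b c Eb Ec aE.
  by apply: no_sum; exists b, c.
have gt0 d : E d -> (0 < d.1 + d.2)%N by case: d => [[|d1] [|d2]] //= /E0.
have := (gt0 _ Eb, gt0 _ Ec); rewrite aE /= in lt_an * => -[b_gt0 c_gt0].
by apply: Padd; apply: IHn => //; lia.
Qed.

Section MinimalGenerators.
Variable R : realType.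
Local Notation OV := (OV R).
Implicit Types (S W T : set OV).

Lemma generated_sub W : W `<=` generated_semigroup W.
Proof. by move=> f Wf T [_]; apply. Qed.

Lemma generated_mul W : mul_closed (generated_semigroup W).
Proof. by move=> f g Wf Wg T WT; apply: (WT.1); [apply: Wf|apply: Wg]. Qed.

Lemma generated_min W T :
  mul_closed T -> W `<=` T -> generated_semigroup W `<=` T.
Proof. by move=> Tmul WT f; apply; split. Qed.

(** A generating set cannot do without an irreducible element, and it can always spare a reducible
    one. *)
Lemma exponents_atom (u v : OV) (E : set (nat * nat)) S W :
    injective (fun rs : nat * nat => u ^+ rs.1 * v ^+ rs.2) ->
    S = [set u ^+ rs.1 * v ^+ rs.2 | rs in E] ->
    ~ E (0, 0)%N -> (forall a b, E a -> E b -> E (pair_add a b)) ->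
    minimal_generators S W -> 
  forall rs, exponents u v W rs <-> atom E rs.
Proof.
set mono := fun rs : nat * nat => u ^+ rs.1 * v ^+ rs.2.
move=> mono_inj SE E0 Eadd [genW minW].
have monoD a b : mono (pair_add a b) = mono a * mono b.
  by rewrite /mono /= !exprD mulrACA.
have monoE a : S (mono a) <-> E a.
  by rewrite SE; split=> [[b Eb /mono_inj <-]|Ea] //; exists a.
have Smul : mul_closed S by rewrite -genW; apply: generated_mul.
have WS : W `<=` S by rewrite -genW; apply: generated_sub.
move=> rs; split=> [Wrs|[Ers rs_atom]]; last first.
  (* [W] together with all products of two elements of [S] is closed under multiplication, hence
     contains [S]. An irreducible monomial is no such product, so it lies in [W]. *)
  pose T := W `|` [set f | exists g h, [/\ S g, S h & f = g * h]].
  have TS : T `<=` S by move=> f [/WS//|[g [h [Sg Sh ->]]]]; apply: Smul.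
  have : T (mono rs).
    have : generated_semigroup W (mono rs) by rewrite genW; apply/monoE.
    apply: generated_min => [f g Tf Tg|f Wf]; last by left.
    by right; exists f, g; split=> //; apply: TS.
  case=> // -[g [h []]]; rewrite SE => -[a Ea <-] [b Eb <-].
  by rewrite -monoD => /mono_inj rsE; case: (rs_atom a b).
have Ers : E rs by apply/monoE/WS.
split=> // a b Ea Eb rsE.
(* If [rs] is a sum, its two parts have smaller degree and are generated without [mono rs]; dropping
   it from [W] therefore contradicts minimality. *)
pose W' : set OV := [set f | W f /\ f <> mono rs].
have W'W : W' `<=` W by move=> f [].
have lt_gen c : E c -> (c.1 + c.2 < rs.1 + rs.2)%N ->
    generated_semigroup W' (mono c).
  move=> /monoE; rewrite -genW.
  (* The degree bound is a condition inside [T], so that [T] is closed under products: the factors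
     of a monomial of small degree have small degree as well. *)
  pose T : set OV := [set f | S f /\ forall c, f = mono c ->
    (c.1 + c.2 < rs.1 + rs.2)%N -> generated_semigroup W' f].
  suff : generated_semigroup W `<=` T by move=> genT /genT[_ /(_ c)]; apply.
  apply: generated_min => [f g [Sf Tf] [Sg Tg]|f Wf].
    split; first exact: Smul.
    move: Sf Sg Tf Tg; rewrite SE => -[d _ <-] [e _ <-] Td Te k.
    rewrite -monoD => /mono_inj <- /= lt_rs.
    by rewrite monoD; apply: generated_mul; [apply: (Td d)|apply: (Te e)] => //; lia.
  split; first exact: WS.
  move=> d fE lt_d; apply: generated_sub; split=> //.
  by rewrite fE => /mono_inj d_rs; rewrite d_rs ltnn in lt_d.
have gt0 c : E c -> (0 < c.1 + c.2)%N.
  by case: c => [[|c1] [|c2]] //= /E0.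
have genW'_rs : generated_semigroup W' (mono rs).
  have := (gt0 _ Ea, gt0 _ Eb); move: lt_gen; rewrite rsE monoD /= => lt_gen [? ?].
  by apply: generated_mul; apply: lt_gen => //; lia.
suff W'E : W' = W by have [] : W' (mono rs) by rewrite W'E.
apply: minW => //; apply/seteqP; split=> f.
  rewrite -genW; apply: generated_min; first exact: generated_mul.
  by move=> g /W'W /generated_sub.
rewrite -genW; apply: generated_min; first exact: generated_mul.
move=> g Wg; have [->//|ne] := pselect (g = mono rs).
by apply: generated_sub.
Qed.

End MinimalGenerators.

(** * Weights of invariant monomials *)

(** One closed quadrant of [L] without the origin, folded into pairs of naturals. The sign given by
    [b] is that of the second variable's weight: 1 for x2, -1 for y2. *)
Definition quadrant (L : set (int * int)) (b : bool) : set (nat * nat) :=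
  [set rs | rs <> (0, 0)%N /\ L (rs.1%:Z, (-1) ^+ b * rs.2%:Z)].

Section Lattice.
Variable L : set (int * int).
Hypothesis L0 : L (0, 0).
Hypothesis LB : forall z z', L z -> L z' -> L (z.1 - z'.1, z.2 - z'.2).

Lemma latticeN z : L z -> L (- z.1, - z.2).
Proof. by move=> /(LB L0); rewrite /= !sub0r. Qed.

Lemma latticeD z z' : L z -> L z' -> L (z.1 + z'.1, z.2 + z'.2).
Proof. by move=> Lz /latticeN /(LB Lz); rewrite /= !opprK. Qed.

Lemma quadrant0 b : ~ quadrant L b (0, 0)%N.
Proof. by case. Qed.

Lemma quadrantD b rs rs' : quadrant L b rs -> quadrant L b rs' ->
  quadrant L b (pair_add rs rs').
Proof.
move=> [ne0 Lrs] [_ Lrs']; split.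
  by case: rs rs' ne0 {Lrs Lrs'} => [[|r] [|s]] [r' s'].
by have := latticeD Lrs Lrs'; rewrite /= !PoszD mulrDr.
Qed.

(** Otherwise the difference is a nonzero element of the same quadrant, and the larger atom splits
    as the smaller one plus the difference. *)
Lemma atom_incomparable b rs rs' :
  atom (quadrant L b) rs -> atom (quadrant L b) rs' ->
  (rs.1 <= rs'.1)%N -> (rs.2 <= rs'.2)%N -> rs = rs'.
Proof.
case: rs rs' => r s [r' s'] [Ers _] [Ers' irr] /= le_r le_s.
have [[e1 e2]|ne] := pselect (r' - r = 0 /\ s' - s = 0)%N.
  by congr (_, _); lia.
case: (irr (r, s) (r' - r, s' - s)%N) => //; last by rewrite /pair_add !subnKC.
split; first by case=> e1 e2; apply: ne.
by have := LB Ers'.2 Ers.2; rewrite /= -mulrBr !subzn.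
Qed.

(** Proportional pairs are comparable. This gives the independence of two relations coming from the
    same quadrant. *)
Lemma atom_nonproportional b r s r' s' :
  atom (quadrant L b) (r, s) -> atom (quadrant L b) (r', s') ->
  (r * s' = r' * s)%N -> (0 < r)%N -> (0 < r')%N -> (r, s) = (r', s').
Proof.
move=> Ars Ars' prop r_gt0 r'_gt0.
have [le_r|lt_r] := leqP r r'.
  by apply: atom_incomparable Ars Ars' _ _ => //=; nia.
by apply/esym; apply: atom_incomparable Ars' Ars _ _ => //=; nia.
Qed.

(** On the first axis the sign is invisible; on the second it is undone by negation in [L]. *)
Lemma quadrant_axis b b' r s : (r == 0)%N || (s == 0)%N ->
  quadrant L b (r, s) -> quadrant L b' (r, s).
Proof.
move=> axis [ne0 Lrs]; split=> //=; move: Lrs => /=.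
have [->|s_neq0] := eqVneq s 0%N; first by rewrite !mulr0.
have -> : r = 0%N by move: axis; rewrite (negbTE s_neq0) orbF => /eqP.
move=> Ls; have := latticeN Ls; rewrite /= oppr0 => LNs.
by case: b b' Ls LNs {ne0} => [] [] /=; rewrite ?expr0 ?expr1 !(mulN1r, mul1r) ?opprK.
Qed.

(** The source of the double edges. Both summands of a point on an axis lie on that axis, so
    decompositions carry over from one quadrant to the other. *)
Lemma atom_axis b b' r s : (r == 0)%N || (s == 0)%N ->
  atom (quadrant L b) (r, s) -> atom (quadrant L b') (r, s).
Proof.
move=> axis [Ers irr]; split; first exact: quadrant_axis Ers.
move=> [a1 a2] [b1 b2] Ea Eb rsE; case: rsE (rsE) => e1 e2 rsE.
apply: (irr (a1, a2) (b1, b2)) rsE; apply: (quadrant_axis (b := b')) => //; lia.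
Qed.

End Lattice.

Section DiagonalInvariants.
Variable K : fieldType.

Lemma invmx_diag n (A : 'M[K]_n) i j : A \in unitmx -> is_diag_mx A ->
  (A i i != 0) /\ invmx A i j = (A i i)^-1 *+ (i == j).
Proof.
move=> Aunit /is_diag_mxP Adiag.
have AV k : A i i * invmx A i k = (i == k)%:R.
  have /matrixP/(_ i k) := mulmxV Aunit; rewrite !mxE => <-.
  rewrite (bigD1 i) //= big1 ?addr0 // => l ne_li.
  by rewrite Adiag ?mul0r // eq_sym.
have Aii_neq0 : A i i != 0.
  apply/eqP => Aii; have /eqP := AV i.
  by rewrite Aii mul0r eqxx eq_sym oner_eq0.
split=> //; apply: (mulfI Aii_neq0); rewrite AV.
by case: eqP => _; rewrite ?mulr0 // divff.
Qed.

Lemma comp_mpolyX_diag n (A : 'M[K]_n) (m : 'X_{1..n}) : is_diag_mx A ->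
  'X_[m] \mPo [tuple \sum_j A i j *: 'X_j | i < n]
    = (\prod_i A i i ^+ m i) *: 'X_[m] :> {mpoly K[n]}.
Proof.
move=> /is_diag_mxP Adiag.
rewrite comp_mpolyE msuppX big_seq1 mcoeffX eqxx scale1r.
rewrite (eq_bigr (fun i => A i i ^+ m i *: 'X_i ^+ m i)) => [|i _].
  by rewrite scaler_prod -mpolyXE_id.
rewrite -exprZn tnth_mktuple (bigD1 i) //= big1 ?addr0 // => j ne_ji.
by rewrite Adiag ?scale0r // eq_sym.
Qed.

End DiagonalInvariants.

Lemma prod_ord2 (S : comNzRingType) (F : 'I_2 -> S) : \prod_(i < 2) F i = F 0 * F 1.
Proof. by rewrite big_ord_recl big_ord1; congr (_ * F _); apply/val_inj. Qed.

Section Weights.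
Variable R : realType.
Local Notation K := R[i].
Local Notation OV := (OV R).
Variable G : {fset 'M[K]_2}.
Hypothesis G_group : is_finite_subgroup_GL G.
Hypothesis G_diag : forall g, g \in G -> is_diag_mx g.

(** The lattice of characters of the diagonal torus that are trivial on [G]. *)
Definition invariant_weights : set (int * int) :=
  [set z | forall g, g \in G -> g 0 0 ^ z.1 * g 1 1 ^ z.2 = 1].

Definition weight (m : 'X_{1..2 + 2}) : int * int :=
  ((m ix1)%:Z - (m iy1)%:Z, (m ix2)%:Z - (m iy2)%:Z).

Lemma diag_neq0 g i : g \in G -> g i i != 0.
Proof.
case: G_group => Gunit _ _ _ gG.
by case: (invmx_diag i i (Gunit g gG) (G_diag gG)).
Qed.

Lemma invariant_weights0 : invariant_weights (0, 0).
Proof. by move=> g gG; rewrite !expr0z mulr1. Qed.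

Lemma invariant_weightsB z z' : invariant_weights z -> invariant_weights z' ->
  invariant_weights (z.1 - z'.1, z.2 - z'.2).
Proof.
move=> Lz Lz' g gG /=; rewrite !expfzDr ?diag_neq0 // mulrACA Lz // mul1r.
by rewrite -!invr_expz -invfM Lz' // invr1.
Qed.

Lemma precompX g (m : 'X_{1..2 + 2}) : g \in G ->
  precomp (sp_of_gl g) ('X_[m] : OV)
    = (g 0 0 ^ (weight m).1 * g 1 1 ^ (weight m).2) *: 'X_[m].
Proof.
case: G_group => Gunit _ _ _ gG; have g_unit := Gunit g gG.
have invE i j := (invmx_diag i j g_unit (G_diag gG)).2.
apply: etrans (comp_mpolyX_diag _ _) _.
  rewrite is_diag_block_mx // !eqxx (G_diag gG) /=; apply/is_diag_mxP => i j ne_ij.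
  by rewrite mxE invE -val_eqE /= eq_sym (negbTE ne_ij).
congr (_ *: _); rewrite big_split_ord.
rewrite !prod_ord2 !block_mxEul !block_mxEdr !mxE !invE !eqxx !mulr1n /=.
rewrite !expfzDr ?diag_neq0 // -!exprnN -!exprVn !exprnP; ring.
Qed.

Lemma invariants_monomial (m : 'X_{1..2 + 2}) :
  invariants G ('X_[m] : OV) <-> invariant_weights (weight m).
Proof.
split=> inv g gG; last by rewrite precompX // inv // scale1r.
have := congr1 (mcoeff m) (inv g gG).
by rewrite precompX // mcoeffZ mcoeffX eqxx mulr1.
Qed.

Lemma precomp_linear (A : 'M[K]_(2 + 2)) : linear (precomp A : OV -> OV).
Proof. by move=> c f g; rewrite /precomp linearP. Qed.

(** A diagonal matrix scales each monomial separately, so coefficients can be compared one monomial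
    at a time. *)
Lemma invariants_support (f : OV) m :
  invariants G f -> m \in msupp f -> invariant_weights (weight m).
Proof.
move=> inv m_f g gG; have := congr1 (mcoeff m) (inv g gG).
rewrite (linear_mpoly_sum _ (precomp_linear _)) raddf_sum /=.
rewrite (bigD1_seq m) ?msupp_uniq //= big1 => [|m' ne_m].
  rewrite precompX // !mcoeffZ mcoeffX eqxx mulr1 addr0 -[RHS]mulr1.
  by apply: mulfI; rewrite -mcoeff_msupp.
by rewrite precompX // !mcoeffZ mcoeffX (negbTE ne_m) !mulr0.
Qed.

(* b = false encodes x1^r x2^s, and b = true encodes x1^r y2^s. *)
Definition signed_monomial (b : bool) (rs : nat * nat) : 'X_{1..2 + 2} :=
  if b then mon4 rs.1 0 0 rs.2 else mon4 rs.1 rs.2 0 0.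

Definition second_variable (b : bool) : OV := if b then y2 else x2.

Lemma signed_monomialE b rs :
  x1 ^+ rs.1 * second_variable b ^+ rs.2 = 'X_[signed_monomial b rs].
Proof. by case: b; rewrite mpolyX_mon4 !expr0 !mulr1. Qed.

Lemma weight_signed b rs :
  weight (signed_monomial b rs) = (rs.1%:Z, (-1) ^+ b * rs.2%:Z).
Proof.
case: b; rewrite /weight /signed_monomial !mon4E subr0.
  by rewrite sub0r mulN1r.
by rewrite subr0 mul1r.
Qed.

Lemma signed_monomial_inj b : injective (signed_monomial b).
Proof.
move=> [r s] [r' s'] e; have E i := congr1 (fun m : 'X_{1..2 + 2} => m i) e.
case: b {e} E => E; move: (E ix1) (E ix2) (E iy2); rewrite !mon4E => /= *;
  by congr (_, _).
Qed.

Lemma invariant_monomialsE b :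
  invariant_monomials G x1 (second_variable b) =
    [set x1 ^+ rs.1 * second_variable b ^+ rs.2
       | rs in quadrant invariant_weights b].
Proof.
apply/seteqP; split=> f /=.
  move=> [r [s [ne0 -> inv]]]; exists (r, s) => //; split=> //=.
  rewrite -(weight_signed b (r, s)); apply/invariants_monomial.
  by rewrite -signed_monomialE.
move=> [[r s] [ne0 Lrs] <-]; exists r, s; split=> //.
rewrite (signed_monomialE b (r, s)); apply/invariants_monomial.
by rewrite weight_signed.
Qed.

Lemma exponents_quadrant b W :
  minimal_generators (invariant_monomials G x1 (second_variable b)) W ->
  forall rs, exponents x1 (second_variable b) W rs <->
    atom (quadrant invariant_weights b) rs.
Proof.
apply: exponents_atom (invariant_monomialsE b) _ _.
- by move=> rs rs' /=; rewrite !signed_monomialE => /mpolyX_inj/signed_monomial_inj.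
- exact: quadrant0.
exact: quadrantD invariant_weights0 invariant_weightsB _.
Qed.

End Weights.

(** * The graph *)

Lemma left_end_inj p q p' q' : left_end p q = left_end p' q' -> (p, q) = (p', q').
Proof. by case=> e1 e2; congr (_, _); lia. Qed.

(** The left end always has the larger first coordinate, so the unordered pair of ends determines
    the orientation. *)
Lemma end_asym p q p' q' :
  left_end p q = right_end p' q' -> left_end p' q' = right_end p q -> False.
Proof. by case=> e1 e2 []; lia. Qed.

Section Graph.
Variables (R : realType) (V1 V2 : set (OV R)) (L : set (int * int)).
Hypothesis L0 : L (0, 0).
Hypothesis LB : forall z z', L z -> L z' -> L (z.1 - z'.1, z.2 - z'.2).
Hypothesis V1E : forall rs, exponents x1 x2 V1 rs <-> atom (quadrant L false) rs.
Hypothesis V2E : forall rs, exponents x1 y2 V2 rs <-> atom (quadrant L true) rs.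
Local Notation Gr := (Gamma V1 V2).
Implicit Types (e : edge Gr) (u v w : vertex Gr) (l : bool * (nat * nat)).

Definition label e : bool * (nat * nat) :=
  match e with inl e1 => (false, val e1.1) | inr e2 => (true, val e2.1) end.

(* The pair (p, q) = (a + r, b + s): the edge joins (p, q - 1) and (p - 1, q). *)
Definition spot e : nat * nat :=
  pair_add (match e with inl e1 => e1.2 | inr e2 => e2.2 end) (label e).2.

(** The labels of the edges at the spot [(p, q)]: the inequalities say that a = p - r and b = q - s
    are nonnegative. *)
Definition available (p q : nat) : set (bool * (nat * nat)) :=
  [set l | [/\ atom (quadrant L l.1) l.2, (l.2.1 <= p)%N & (l.2.2 <= q)%N]].

Lemma ends_spot e : ends e =
  (left_end (spot e).1 (spot e).2, right_end (spot e).1 (spot e).2).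
Proof. by case: e => [[[[r s] h] [a b]]|[[[r s] h] [a b]]]. Qed.

Lemma label_spot_inj e e' : label e = label e' -> spot e = spot e' -> e = e'.
Proof.
have ab_eq (ab ab' rs : nat * nat) : pair_add ab rs = pair_add ab' rs -> ab = ab'.
  by case: ab ab' => a b [a' b'] [/= e1 e2]; congr (_, _); lia.
case: e e' => [[rs ab]|[rs ab]] [[rs' ab']|[rs' ab']] //= [/val_inj <-];
  by rewrite /spot /= => /ab_eq <-.
Qed.

Lemma label_available e : available (spot e).1 (spot e).2 (label e).
Proof.
split; rewrite ?leq_addl //.
by case: e => [[[rs rs_in] ab]|[[rs rs_in] ab]];
  [apply/V1E/set_mem|apply/V2E/set_mem].
Qed.

Lemma edge_exists p q l :
  available p q l -> exists e, label e = l /\ spot e = (p, q).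
Proof.
case: l => [b [r s]] [/= rs_atom le_r le_s].
have spotE : pair_add (p - r, q - s)%N (r, s) = (p, q) by rewrite /pair_add /= !subnK.
case: b rs_atom => [/V2E|/V1E] rs_in.
  by exists (inr (exist _ (r, s) (mem_set rs_in), (p - r, q - s)%N)).
by exists (inl (exist _ (r, s) (mem_set rs_in), (p - r, q - s)%N)).
Qed.

Lemma joins_spot e u v p q : spot e = (p, q) -> joins e u v ->
  (u = left_end p q /\ v = right_end p q) \/ (u = right_end p q /\ v = left_end p q).
Proof. by move=> eE; rewrite /joins ends_spot eE => -[] [<- <-]; [left|right]. Qed.

Lemma joins_same_spot e e' u v : joins e u v -> joins e' u v -> spot e = spot e'.
Proof.
case E: (spot e) => [p q]; case E': (spot e') => [p' q'].
move=> /(joins_spot E)[] [-> ->] /(joins_spot E')[] [e1 e2].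
- exact: left_end_inj.
- by case: (end_asym e1); rewrite e2.
- by case: (end_asym e2); rewrite -e1.
exact: left_end_inj.
Qed.

Lemma joins_sym e u v : joins e u v -> joins e v u.
Proof. by case; [right|left]. Qed.

Lemma adjacent_ends p q l :
  available p q l -> adjacent (Gr := Gr) (left_end p q) (right_end p q).
Proof.
by move=> /edge_exists[e [_ eE]]; exists e; left; rewrite ends_spot eE.
Qed.

Lemma component_sym u v : component u v -> component v u.
Proof.
elim=> [w w' [e /joins_sym e_join]|w|w w' w'' _ + _]; first by apply: rt_step; exists e.
  exact: rt_refl.
by move=> ww' w'w''; apply: rt_trans w'w'' ww'.
Qed.

(** * Consequences of the edge relations along a component *)

Section Relations.
Variables (K : numFieldType) (M : lmodType K) (S : lattice_point -> M).
Hypothesis S_boundary : forall v, ~~ nonneg_pt v -> S v = 0.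
Hypothesis S_relation : forall p q l, available p q l ->
  l.2.1%:R *: S (right_end p q) + ((-1) ^+ l.1 * l.2.2%:R) *: S (left_end p q) = 0.

Lemma signed_natr_neq0 (b : bool) n : (0 < n)%N -> (-1) ^+ b * n%:R != 0 :> K.
Proof. by move=> n_gt0; rewrite mulf_neq0 ?signr_eq0 // pnatr_eq0 -lt0n. Qed.

Lemma axis_zero p q b r s : available p q (b, (r, s)) -> (r == 0)%N || (s == 0)%N ->
  S (left_end p q) = 0 /\ S (right_end p q) = 0.
Proof.
move=> [[[ne0 Lrs] irr] /= le_r le_s] /orP[]/eqP axis.
- have s_gt0 : (0 < s)%N by rewrite lt0n; apply/eqP => s0; apply: ne0; rewrite axis s0.
  have left0 p' q' : (s <= q')%N -> S (left_end p' q') = 0.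
    move=> le_s'; have /S_relation : available p' q' (b, (r, s)).
      by split=> //=; rewrite axis.
    rewrite /= axis scale0r add0r => /eqP; rewrite scaler_eq0.
    by rewrite (negbTE (signed_natr_neq0 _ s_gt0)) => /eqP.
  split; first exact: left0.
  (* The right end is a boundary vertex, or else the left end of the next spot on the same
     antidiagonal, where the generator still fits. *)
  case: p {le_r} => [|p]; first by apply: S_boundary; rewrite nonneg_right.
  by rewrite right_endS -left_endS left0 // leqW.
have r_gt0 : (0 < r)%N by rewrite lt0n; apply/eqP => r0; apply: ne0; rewrite axis r0.
have right0 p' q' : (r <= p')%N -> S (right_end p' q') = 0.
  move=> le_r'; have /S_relation : available p' q' (b, (r, s)).
    by split=> //=; rewrite axis.
  rewrite /= axis mulr0 scale0r addr0 => /eqP; rewrite scaler_eq0.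
  by rewrite pnatr_eq0 (gtn_eqF r_gt0) => /eqP.
split; last exact: right0.
case: q {le_s} => [|q]; first by apply: S_boundary; rewrite nonneg_left.
by rewrite left_endS -right_endS right0 // leqW.
Qed.

Lemma adjacent_scale u v : adjacent (Gr := Gr) u v ->
  exists2 c : K, c != 0 & S u = c *: S v.
Proof.
move=> [e e_joins]; have := label_available e.
case: (label e) (joins_spot (surjective_pairing _) e_joins) => b [r s].
move: (spot e).1 (spot e).2 => p q uv av.
have [|] := boolP ((r == 0)%N || (s == 0)%N).
  (* Both values are zero here, so any nonzero scalar would do. *)
  move=> /(axis_zero av)[Sl Sr]; exists 1; rewrite ?oner_neq0 // scale1r.
  by case: uv => -[-> ->]; rewrite Sl Sr.
rewrite negb_or -!lt0n => /andP[r_gt0 s_gt0].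
have r_neq0 : r%:R != 0 :> K by rewrite pnatr_eq0 -lt0n.
have s_neq0 := signed_natr_neq0 b s_gt0.
have /eqP := S_relation av; rewrite addr_eq0 /= => /eqP Sr.
case: uv => -[-> ->].
  exists (- (((-1) ^+ b * s%:R)^-1 * r%:R)).
    by rewrite oppr_eq0 mulf_neq0 ?invr_eq0.
  by rewrite scaleNr -scalerA Sr scalerN opprK scalerA mulVf // scale1r.
exists (- (r%:R^-1 * ((-1) ^+ b * s%:R))).
  by rewrite oppr_eq0 mulf_neq0 ?invr_eq0.
by rewrite scaleNr -scalerA -scalerN -Sr scalerA mulVf // scale1r.
Qed.

Lemma component_scale u v : component u v -> exists2 c : K, c != 0 & S u = c *: S v.
Proof.
elim=> [w w'|w|w w' w'' _ [c c0 ->] _ [c' c'0 ->]]; first exact: adjacent_scale.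
  by exists 1; rewrite ?oner_neq0 ?scale1r.
by exists (c * c'); rewrite ?mulf_neq0 // scalerA.
Qed.

Lemma multiple_edge_zero e e' u v : joins e u v -> joins e' u v -> e <> e' -> S u = 0.
Proof.
move=> e_uv e'_uv ne; have spotE := joins_same_spot e_uv e'_uv.
have ne_label : label e <> label e' by move=> /label_spot_inj /(_ spotE).
have := (label_available e, label_available e'); rewrite -spotE.
case: (label e) (label e') ne_label (joins_spot (surjective_pairing _) e_uv).
move=> b [r s] [b' [r' s']] ne_label.
move: (spot e).1 (spot e).2 => p q uv [av av'].
suff [Sl Sr] : S (left_end p q) = 0 /\ S (right_end p q) = 0.
  by case: uv => -[-> _].
have [/(axis_zero av) //|] := boolP ((r == 0)%N || (s == 0)%N).
have [/(axis_zero av') //|] := boolP ((r' == 0)%N || (s' == 0)%N).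
rewrite !negb_or -!lt0n => /andP[r'_gt0 s'_gt0] /andP[r_gt0 s_gt0].
set A := S (left_end p q); set B := S (right_end p q).
have relA : r%:R *: B + ((-1) ^+ b * s%:R) *: A = 0 := S_relation av.
have relA' : r'%:R *: B + ((-1) ^+ b' * s'%:R) *: A = 0 := S_relation av'.
(* The determinant of the two relations at this spot; once it is nonzero, elimination kills both
   ends. *)
pose det : K := (-1) ^+ b' * s'%:R * r%:R - (-1) ^+ b * s%:R * r'%:R.
have det_neq0 : det != 0.
  rewrite /det; have [eq_b|ne_b] := eqVneq b b'.
    rewrite -eq_b -!mulrA -mulrBr mulf_neq0 ?signr_eq0 // subr_eq0 -!natrM eqr_nat.
    apply/eqP => prop; apply: ne_label; rewrite -eq_b in av' *; congr (_, _).
    case: av av' => [a _ _] [a' _ _].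
    by apply: (atom_nonproportional LB a a') => //; lia.
  (* For labels from opposite quadrants the two terms of the determinant have the same sign and
     cannot cancel. *)
  have -> : b' = ~~ b by case: (b) (b') ne_b => [] [].
  have -> : (-1) ^+ (~~ b) * s'%:R * r%:R - (-1) ^+ b * s%:R * r'%:R
      = - ((-1) ^+ b * (s'%:R * r%:R + s%:R * r'%:R)) :> K by rewrite signrN; ring.
  by rewrite oppr_eq0 mulf_neq0 ?signr_eq0 // -!natrM -natrD pnatr_eq0 -lt0n; nia.
have B0 : B = 0.
  apply/eqP; have /eqP : det *: B = 0; last by rewrite scaler_eq0 (negbTE det_neq0).
  have -> : det *: B = ((-1) ^+ b' * s'%:R) *: (r%:R *: B + ((-1) ^+ b * s%:R) *: A)
      - ((-1) ^+ b * s%:R) *: (r'%:R *: B + ((-1) ^+ b' * s'%:R) *: A).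
    rewrite !scalerDr !scalerA opprD addrACA [X in _ *: A - X *: A]mulrC.
    by rewrite subrr addr0 -scalerBl.
  by rewrite relA relA' !scaler0 subr0.
split=> //; move: relA; rewrite B0 scaler0 add0r => /eqP.
by rewrite scaler_eq0 (negbTE (signed_natr_neq0 _ s_gt0)) => /eqP.
Qed.

(** If [S v] is nonzero, so is [S] on the whole component, which excludes boundary vertices and
    multiple edges. *)
Lemma nonsimple_zero v :
  ~ simple_components V1 V2 (component (Gr := Gr) v) -> S v = 0.
Proof.
move=> not_simple; apply: contrapT => Sv; apply: not_simple.
have Sw w : component (Gr := Gr) v w -> S w <> 0.
  by move=> /component_scale[c _ Svw] Sw; apply: Sv; rewrite Svw Sw scaler0.
split; first by exists v.
  by move=> w /Sw Sw0; apply: contrapT => /negP/S_boundary.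
move=> u w vu vw [e e_uw]; exists e; split=> // e' e'_uw.
by apply: contrapT => ne; apply: (Sw u vu); apply: multiple_edge_zero e_uw e'_uw ne.
Qed.

End Relations.

(** * The weight function of a simple component *)

Section SimpleComponent.
Variables (K : numFieldType) (D : set lattice_point).
Hypothesis D_simple : simple_components V1 V2 D.

Lemma simple_adjacent u v : D u -> adjacent (Gr := Gr) u v -> D v.
Proof.
case: D_simple => -[w _ <-] _ _ wu uv.
by apply: rt_trans wu _; apply: rt_step.
Qed.

Lemma simple_component_eq v : D v -> D = component (Gr := Gr) v.
Proof.
case: D_simple => -[w _ <-] _ _ wv; apply/seteqP; split=> u wu.
  by apply: rt_trans wu; apply: component_sym.
exact: rt_trans wv wu.
Qed.

Lemma simple_edge p q l : available p q l ->
  D (left_end p q) \/ D (right_end p q) ->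
  [/\ D (left_end p q), D (right_end p q), (0 < p)%N & (0 < q)%N] /\
  [/\ (0 < l.2.1)%N, (0 < l.2.2)%N & forall l', available p q l' -> l' = l].
Proof.
move=> av Dlr; have adj := adjacent_ends av.
have [Dl Dr] : D (left_end p q) /\ D (right_end p q).
  case: Dlr => [Dl|Dr]; split=> //; first exact: simple_adjacent adj.
  by apply: simple_adjacent Dr _; case: adj => e /joins_sym; exists e.
case: D_simple => _ D_ge0 D_unique.
have [e0 [_ uniq_e]] := D_unique _ _ Dl Dr adj.
have uniq_l l1 l2 : available p q l1 -> available p q l2 -> l1 = l2.
  have e0E e : spot e = (p, q) -> e0 = e.
    by move=> eE; apply: uniq_e; left; rewrite ends_spot eE.
  by move=> /edge_exists[e1 [<- /e0E <-]] /edge_exists[e2 [<- /e0E <-]].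
split.
  by split=> //; rewrite -?(nonneg_right p q) -?(nonneg_left p q); apply: D_ge0.
split; last by move=> l' av'; apply: uniq_l.
(* A generator on an axis belongs to both families and would put two labels at this spot. *)
all: rewrite lt0n; apply/negP => axis.
all: case: l av axis => [b [r s]] [/= rs_atom le_r le_s] axis.
all: have av b' : available p q (b', (r, s)) by
  split=> //=; move: rs_atom; apply: (@atom_axis L L0 LB);
  move: axis => /= ->; rewrite ?orbT.
all: by have [] := uniq_l _ _ (av true) (av false).
Qed.

(* Only off-axis labels are considered, so that the ratio never vanishes, even at
   the edges outside D that occur in the product defining component_weight. *)
Definition edge_ratio (p q : nat) : K :=
  let l := xget (false, (1, 1)%N)
    [set l | [/\ available p q l, (0 < l.2.1)%N & (0 < l.2.2)%N]] in
  - (l.2.1%:R / ((-1) ^+ l.1 * l.2.2%:R)).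

Lemma edge_ratio_neq0 p q : edge_ratio p q != 0.
Proof.
(* Where no off-axis label is available, the default [(1, 1)] gives the ratio -1. *)
rewrite /edge_ratio; case: xgetP => [l _ [_ l1 l2]|_];
  rewrite oppr_eq0 mulf_neq0 ?invr_eq0 ?mulf_neq0 ?signr_eq0 ?pnatr_eq0 -?lt0n //.
Qed.

(** Edges preserve j + k. The product runs along the antidiagonal from (0, j + k) to (j, k), with
    factor [i] taken at the spot (i, j + k + 1 - i). The starting point affects only the overall
    scalar. *)
Definition component_weight (v : lattice_point) : K :=
  if `[< D v >] then
    \prod_(1 <= i < `|(val v).1|%N.+1)
      edge_ratio i (`|(val v).1|%N + `|(val v).2|%N + 1 - i)%N
  else 0.

Lemma component_weight0 (v : lattice_point) : ~ D v -> component_weight v = 0.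
Proof. by move=> /asboolPn/negbTE nDv; rewrite /component_weight nDv. Qed.

Lemma component_weight_neq0 (v : lattice_point) : D v -> component_weight v != 0.
Proof.
move=> /asboolP Dv; rewrite /component_weight Dv.
apply: (big_ind (fun x : K => x != 0)) => [|x y x0 y0|i _].
- exact: oner_neq0.
- exact: mulf_neq0.
exact: edge_ratio_neq0.
Qed.

Lemma component_weight_step p q : D (left_end p.+1 q.+1) -> D (right_end p.+1 q.+1) ->
  component_weight (left_end p.+1 q.+1)
    = component_weight (right_end p.+1 q.+1) * edge_ratio p.+1 q.+1.
Proof.
rewrite left_endS right_endS => /asboolP Dl /asboolP Dr.
rewrite /component_weight Dl Dr big_nat_recr //=; congr (_ * edge_ratio _ _); last lia.
by apply: eq_bigr => i _; congr edge_ratio; lia.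
Qed.

Lemma component_weight_relation p q l : available p q l ->
  l.2.1%:R * component_weight (right_end p q)
    + (-1) ^+ l.1 * l.2.2%:R * component_weight (left_end p q) = 0.
Proof.
move=> av.
have [Dlr|nDlr] := pselect (D (left_end p q) \/ D (right_end p q)); last first.
  by rewrite !component_weight0 ?mulr0 ?addr0 // => ?; apply: nDlr; [left|right].
have [[Dl Dr p_gt0 q_gt0] [r_gt0 s_gt0 l_uniq]] := simple_edge av Dlr.
case: p q p_gt0 q_gt0 av Dl Dr l_uniq {Dlr} => [|p] [|q] // _ _ av Dl Dr l_uniq.
(* By uniqueness the label selected by [xget] is [l] itself. *)
rewrite component_weight_step // /edge_ratio (@xget_unique _ _ _ l) //; last first.
  by move=> l' [/l_uniq].
have := signed_natr_neq0 K l.1 s_gt0; set a := _ * _ => a_neq0.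
by field.
Qed.

(** The relation is additive in the weight, so it passes from the generators of the two quadrants to
    all of [L]. *)
Lemma component_weight_lattice (z : int * int) p q :
  L z -> (`|z.1| <= p)%N -> (`|z.2| <= q)%N ->
  z.1%:~R * component_weight (right_end p q)
    + z.2%:~R * component_weight (left_end p q) = 0.
Proof.
set A := component_weight _; set B := component_weight _.
have quad b rs : quadrant L b rs -> (rs.1 <= p)%N -> (rs.2 <= q)%N ->
    rs.1%:R * A + (-1) ^+ b * rs.2%:R * B = 0.
  (* The bounds are kept inside [P] because the summands of a pair within the box are again within
     it. *)
  move=> Ers; pose P := [set rs : nat * nat | (rs.1 <= p)%N -> (rs.2 <= q)%N ->
    rs.1%:R * A + (-1) ^+ b * rs.2%:R * B = 0].
  suff : quadrant L b `<=` P by apply.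
  apply: atom_ind => [|a a_atom a1 a2|a c Pa Pc le1 le2]; first exact: quadrant0.
    exact: (@component_weight_relation p q (b, a)).
  rewrite /= in le1 le2.
  have {}Pa : a.1%:R * A + (-1) ^+ b * a.2%:R * B = 0 by apply: Pa; lia.
  have {}Pc : c.1%:R * A + (-1) ^+ b * c.2%:R * B = 0 by apply: Pc; lia.
  by rewrite !natrD mulrDl mulrDr mulrDl addrACA Pa Pc addr0.
have half r y : L (r%:Z, y) -> (r <= p)%N -> (`|y| <= q)%N ->
    r%:R * A + y%:~R * B = 0.
  move=> Lry le_r le_y.
  have [[-> ->]|ne0] := pselect (r = 0%N /\ y = 0).
    by rewrite !mul0r addr0.
  have yE : y = (-1) ^+ (y < 0)%R * `|y|%N%:Z := intEsign y.
  have := quad (y < 0)%R (r, `|y|%N); rewrite /= => /(_ _ le_r le_y) <-.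
    by rewrite {1}yE intrM rmorphXn /= rmorphN1.
  split; last by rewrite /= -yE.
  by case=> r0 /eqP; rewrite absz_eq0 => /eqP y0; apply: ne0.
(* A negative first coordinate is reduced to [half] by negating the weight, which only changes the
   sign of the relation. *)
case: z => [[r|r] y] Lz le_x le_y; first exact: half.
have LNz := latticeN L0 LB Lz; rewrite /= NegzE opprK in LNz.
have := half _ _ LNz; rewrite abszN => /(_ le_x le_y) /eqP.
rewrite -oppr_eq0 opprD -!mulNr -!mulrNz opprK /= => /eqP <-.
by rewrite NegzE mulrNz.
Qed.

End SimpleComponent.
End Graph.

(** * The quotient and its functionals *)

Section Span.
Variables (K : fieldType) (M : lmodType K) (I : choiceType) (v : I -> M).
Local Open Scope fset_scope.

Definition finitely_spanned (x : M) : Prop :=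
  exists (J : {fset I}) (c : I -> K), x = \sum_(i <- J) c i *: v i.

Lemma finitely_spanned0 : finitely_spanned 0.
Proof. by exists fset0, (fun=> 0); rewrite big_seq_fset0. Qed.

Lemma finitely_spanned1 i : finitely_spanned (v i).
Proof. by exists [fset i], (fun=> 1); rewrite big_seq_fset1 scale1r. Qed.

Lemma finitely_spanned_linear a x y :
  finitely_spanned x -> finitely_spanned y -> finitely_spanned (a *: x + y).
Proof.
move=> [J [c ->]] [J' [c' ->]].
have extend (A : {fset I}) (d : I -> K) : A `<=` J `|` J' ->
    \sum_(i <- A) d i *: v i
      = \sum_(i <- J `|` J') (if i \in A then d i else 0) *: v i.
  move=> sub; rewrite -(big_fset_incl _ sub) => [|i _ /negbTE ->]; last exact: scale0r.
  by apply: eq_big_seq => i ->.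
exists (J `|` J'), (fun i => a * (if i \in J then c i else 0)
  + (if i \in J' then c' i else 0))%R.
rewrite (extend J c) ?fsubsetUl // (extend J' c') ?fsubsetUr //.
by rewrite scaler_sumr -big_split /=; apply: eq_bigr => i _; rewrite scalerDl scalerA.
Qed.

Lemma finitely_spannedZ a x : finitely_spanned x -> finitely_spanned (a *: x).
Proof.
move=> sx; rewrite -[_ *: _]addr0.
exact: finitely_spanned_linear sx finitely_spanned0.
Qed.

End Span.

Section MonomialFunctional.
Variables (n : nat) (K : comNzRingType) (psi : 'X_{1..n} -> K).

Definition monomial_functional (f : {mpoly K[n]}) : K^o :=
  \sum_(m <- msupp f) f@_m * psi m.

Lemma monomial_functionalE k (f : {mpoly K[n]}) : (msize f <= k)%N ->
  monomial_functional f = \sum_(m : 'X_{1..n < k}) f@_m * psi m.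
Proof.
move=> le_fk; rewrite /monomial_functional.
rewrite (big_mksub ('X_{1..n < k})) ?msupp_uniq //=; first last.
  by move=> x /msize_mdeg_lt /leq_trans; apply.
rewrite big_rmcond //= => j /memN_msupp_eq0 ->.
by rewrite mul0r.
Qed.

Lemma monomial_functional_linear : linear monomial_functional.
Proof.
(* A common degree bound puts the three sums, whose supports differ, over one index type. *)
move=> c f g; pose k := maxn (msize (c *: f + g)) (maxn (msize f) (msize g)).
rewrite !(@monomial_functionalE k) ?leq_max ?leqnn ?orbT //.
rewrite scaler_sumr -big_split /=; apply: eq_bigr => m _.
by rewrite mcoeffD mcoeffZ mulrDl -mulrA.
Qed.

Lemma monomial_functionalX m : monomial_functional 'X_[m] = psi m.
Proof. by rewrite /monomial_functional msuppX big_seq1 mcoeffX eqxx mul1r. Qed.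

End MonomialFunctional.

Section PoissonQuotient.
Variable R : realType.
Local Notation K := R[i].
Local Notation OV := (OV R).
Variable G : {fset 'M[K]_2}.
Hypothesis G_group : is_finite_subgroup_GL G.
Hypothesis G_diag : forall g, g \in G -> is_diag_mx g.
Local Notation L := (invariant_weights G).
Local Notation cls := (@HP0_class R (invariants G)).

Lemma HP0_class_linear : linear cls.
Proof.
by move=> c f g; rewrite /HP0_class quot_classD -quot_class_scale.
Qed.

Lemma HP0_bracket (f g : OV) : invariants G f -> cls (poisson f g) = 0.
Proof.
move=> inv; rewrite -(linear0_eq HP0_class_linear); apply/quot_classP.
rewrite subr0; apply/asboolP; exists [:: (1, poisson f g)].
  by move=> p; rewrite inE => /eqP ->; exists f, g.
by rewrite big_seq1 scale1r.
Qed.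

Lemma HP0_unbalanced m : ~~ balanced m -> cls 'X_[m] = 0.
Proof.
have inv a b : invariants G ('X_[mon4 a b a b] : OV).
  apply/invariants_monomial => // g gG.
  by rewrite /weight !mon4E !subrr !expr0z mulr1.
have scale_eq0 (c : K) x : c != 0 -> cls (c *: x) = 0 -> cls x = 0.
  move=> c0; rewrite (linear_scale _ _ HP0_class_linear) => /eqP.
  by rewrite scaler_eq0 (negbTE c0) => /eqP.
rewrite negb_and => /orP[] ne; have := ne; rewrite eq_sym -(eqr_nat K) -subr_eq0.
(* The bracket with x1 y1 multiplies a monomial by its exponent of y1 minus that of x1. *)
- move=> /scale_eq0; apply; rewrite -[RHS](HP0_bracket 'X_[m] (inv 1%N 0%N)).
  rewrite poissonX !mon4E !mul0n !mul1n subrr scale0r addr0; congr (cls (_ *: 'X_[_])).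
  by apply: mon4P; rewrite !(mnmBE, mnmDE, mnm1E) !mon4E /=; lia.
move=> /scale_eq0; apply; rewrite -[RHS](HP0_bracket 'X_[m] (inv 0%N 1%N)).
rewrite poissonX !mon4E !mul0n !mul1n subrr scale0r add0r; congr (cls (_ *: 'X_[_])).
by apply: mon4P; rewrite !(mnmBE, mnmDE, mnm1E) !mon4E /=; lia.
Qed.

Lemma HP0_relation p q l : available L p q l ->
  (l.2.1%:R : K) *: scaled_class cls (right_end p q)
    + ((-1) ^+ l.1 * l.2.2%:R) *: scaled_class cls (left_end p q) = 0.
Proof.
case: l => b [r s] [/= [[_ Lrs] _] le_r le_s].
(* The complement of [m] in u^p v^q; the bounds on [r] and [s] make this subtraction exact. *)
pose m := signed_monomial b (r, s); pose m' := (mon4 p q p q - m)%MM.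
have mm' : (m + m')%MM = mon4 p q p q.
  by apply: mon4P; rewrite mnmDE mnmBE /m; case: (b); rewrite /= !mon4E; lia.
have := poisson_scaled_class HP0_class_linear mm'.
rewrite HP0_bracket; last first.
  by apply/invariants_monomial => //; rewrite weight_signed.
move=> /esym/eqP; rewrite scaler_eq0 (negbTE (fact_neq0 _ _ _)) /= => /eqP <-.
congr (_ *: _ + _ *: _); rewrite /m; case: (b); rewrite /= !mon4E ?subr0 ?mul1r //.
by rewrite sub0r mulN1r.
Qed.

(** * The functional dual to a simple component *)

Section Functional.
Variables (V1 V2 : set OV) (D : set lattice_point).
Hypothesis V1E : forall rs, exponents x1 x2 V1 rs <-> atom (quadrant L false) rs.
Hypothesis V2E : forall rs, exponents x1 y2 V2 rs <-> atom (quadrant L true) rs.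
Hypothesis D_simple : simple_components V1 V2 D.
Local Notation W := (component_weight L K D).

(** The factorials undo the normalisation of e, so that the functional takes the value [W] on
    e(j,k). *)
Definition component_psi (m : 'X_{1..2 + 2}) : K :=
  if balanced m then ((m ix1)`! * (m ix2)`!)%:R * W (nat_point (m ix1) (m ix2)) else 0.

Definition component_functional (f : OV) : K^o :=
  monomial_functional component_psi f.
Local Notation phi := component_functional.

Lemma component_functional_linear : linear phi.
Proof. exact: monomial_functional_linear. Qed.

Lemma component_functionalX m : phi 'X_[m] = component_psi m.
Proof. exact: monomial_functionalX. Qed.

Lemma scaled_component_functional v : scaled_class phi v = W v.
Proof.
have [/nonneg_ptP[j [k ->]]|nv] := boolP (nonneg_pt v); last first.
  rewrite /scaled_class (negbTE nv) component_weight0 // => Dv.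
  by case: D_simple => _ /(_ v Dv) v_ge0 _; rewrite /nonneg_pt v_ge0 in nv.
rewrite scaled_classE component_functionalX /component_psi /balanced !mon4E !eqxx /=.
by apply: mulKf; apply: fact_neq0.
Qed.

Lemma component_functional_bracketX m m' : L (weight m) ->
  phi (poisson ('X_[m] : OV) 'X_[m']) = 0.
Proof.
move=> Lm; have lin := component_functional_linear.
have [bal|unbal] := boolP (balanced (m + m')%MM).
  have [/eqP e1 /eqP e2] := andP bal.
  have mm' : (m + m')%MM = mon4 ((m + m')%MM ix1) ((m + m')%MM ix2)
      ((m + m')%MM ix1) ((m + m')%MM ix2).
    by rewrite {1}[(m + m')%MM]mon4K -e1 -e2.
  rewrite (poisson_scaled_class lin mm') !scaled_component_functional.
  have le_w i j : (m + m')%MM i = (m + m')%MM j ->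
      (`|(m i)%:Z - (m j)%:Z| <= (m + m')%MM i)%N.
    by rewrite !mnmDE; lia.
  have := component_weight_lattice (@invariant_weights0 R G)
    (invariant_weightsB G_group G_diag) V1E V2E K D_simple Lm
    (le_w _ _ e1) (le_w _ _ e2).
  rewrite /weight /= !intrB => rel.
  by apply: etrans (congr1 _ rel) (scaler0 _ _).
(* Removing one x_i and one y_i preserves the weight unless the subtraction is truncated; in that
   case an exponent of the product is zero and both products in the coefficient vanish. *)
have term0 i j : (i, j) \in [:: (ix1, iy1); (ix2, iy2)] ->
    phi (((m i * m' j)%:R - (m j * m' i)%:R) *: 'X_[m + m' - U_(i) - U_(j)]) = 0.
  move=> ij; rewrite (linear_scale _ _ lin) component_functionalX /component_psi.
  case: ifP => [bal|_]; last exact: mulr0.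
  suff [-> ->] : (m i * m' j = 0 /\ m j * m' i = 0)%N by rewrite subrr; apply: mul0r.
  move: unbal bal; rewrite /balanced !mnmBE !mnmDE !mnm1E.
  by move: ij; rewrite !inE => /orP[]/eqP[-> ->] /=; nia.
rewrite poissonX.
rewrite -[X in phi (X + _)]scale1r lin scale1r.
by rewrite !term0 ?inE ?eqxx ?orbT // addr0.
Qed.

Lemma component_functional_bracket f g :
  invariants G f -> phi (poisson f g) = 0.
Proof.
move=> inv; have lin := component_functional_linear.
have linl h : linear (fun f => phi (poisson f h)).
  by move=> c f1 f2; rewrite poisson_linearl lin.
have linr h : linear (fun g => phi (poisson h g)).
  by move=> c f1 f2; rewrite poisson_linearr lin.
rewrite (linear_mpoly_sum _ (linl g)) big_seq big1 // => m m_f.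
rewrite (linear_mpoly_sum _ (linr 'X_[m])) big1 ?scaler0 // => m' _.
rewrite component_functional_bracketX ?scaler0 //.
exact: invariants_support inv m_f.
Qed.

Lemma component_functional_class0 f : cls f = 0 -> phi f = 0.
Proof.
rewrite -(linear0_eq HP0_class_linear) => /quot_classP; rewrite subr0.
move=> /asboolP[s s_br ->]; have lin := component_functional_linear.
elim: s s_br => [|[c h] s IHs] s_br; first by rewrite big_nil (linear0_eq lin).
rewrite big_cons lin IHs => [|p p_s]; last by apply: s_br; rewrite inE p_s orbT.
have [f' [g [inv /= ->]]] := s_br (c, h) (mem_head _ _).
by rewrite component_functional_bracket // scaler0 addr0.
Qed.

Lemma component_functional_vertex v :
  nonneg_pt v -> (phi (vertex_monomial R v) == 0) = ~~ `[< D v >].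
Proof.
move=> /nonneg_ptP[j [k ->]]; rewrite vertex_monomialE class_scaled.
rewrite scaled_component_functional scaler_eq0 (negbTE (fact_neq0 _ _ _)) /=.
have [/asboolP Dv|/asboolPn Dv] := boolP `[< D (nat_point j k) >].
  by apply/negbTE/component_weight_neq0.
by rewrite component_weight0 ?eqxx.
Qed.

End Functional.
End PoissonQuotient.

(** * Independence and spanning of the chosen classes *)

Theorem theorem6p5 (R : realType) (G : {fset 'M[R[i]]_2})
    (G_group : is_finite_subgroup_GL G)
    (G_diag : forall g, g \in G -> is_diag_mx g)
    (V1 V2 : set (OV R))
    (V1_min : minimal_generators (invariant_monomials G x1 x2) V1)
    (V2_min : minimal_generators (invariant_monomials G x1 y2) V2)
    (chosen : simple_components V1 V2 -> lattice_point)
    (chosen_in : forall D : simple_components V1 V2, val D (chosen D)) :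
  is_basis (fun D : simple_components V1 V2 =>
    HP0_class (invariants G) (vertex_monomial R (chosen D))).
Proof.
have V1E := exponents_quadrant G_group G_diag (b := false) V1_min.
have V2E := exponents_quadrant G_group G_diag (b := true) V2_min.
have L0 := @invariant_weights0 R G.
have LB := invariant_weightsB G_group G_diag.
have cls_lin := HP0_class_linear G.
have simple (D : simple_components V1 V2) : simple_components V1 V2 (val D).
  exact/set_mem/(valP D).
have chosen_ge0 D : nonneg_pt (chosen D).
  by case: (simple D) => _ D_ge0 _; apply: D_ge0.
split=> [J c sum0 D D_J|x].
(* The functional of [D] kills the chosen monomials of all other components and thus isolates the
   coefficient of [D]. *)
- pose phi := component_functional G (val D).
  have phi_lin : linear phi := component_functional_linear G (val D).
  pose f := \sum_(i <- J) c i *: vertex_monomial R (chosen i).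
  have : phi f = 0.
    apply: (component_functional_class0 G_group G_diag V1E V2E (simple D)).
    rewrite -[RHS]sum0 /f; elim: (J : seq _) => [|i s IHs].
      by rewrite !big_nil (linear0_eq cls_lin).
    by rewrite !big_cons cls_lin IHs.
  have -> : phi f = \sum_(i <- J) c i *: phi (vertex_monomial R (chosen i)).
    rewrite /f; elim: (J : seq _) => [|i s IHs].
      by rewrite !big_nil (linear0_eq phi_lin).
    by rewrite !big_cons phi_lin IHs.
  have phiE i := component_functional_vertex G (simple D) (chosen_ge0 i).
  rewrite (bigD1_seq D) ?fset_uniq //= big1 => [|i ne_iD].
    rewrite addr0 => /eqP; rewrite scaler_eq0 phiE.
    by have /asboolP -> := chosen_in D; rewrite orbF => /eqP.
  have /eqP -> : phi (vertex_monomial R (chosen i)) == 0; last exact: scaler0.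
  (* Two components that share a vertex coincide. *)
  rewrite phiE; apply/asboolPn => Di; move/eqP: ne_iD; apply; apply/val_inj.
  by rewrite (simple_component_eq (simple D) Di)
    (simple_component_eq (simple i) (chosen_in i)).
rewrite -[x]quot_classK; set f := repr x.
have -> : quot_class (brackets (invariants G)) f = HP0_class (invariants G) f by [].
suff spanX m : finitely_spanned (fun D : simple_components V1 V2 =>
    HP0_class (invariants G) (vertex_monomial R (chosen D)))
    (HP0_class (invariants G) 'X_[m]).
  rewrite (linear_mpoly_sum _ cls_lin); elim: (msupp f) => [|m s IHs].
    by rewrite big_nil; apply: finitely_spanned0.
  by rewrite big_cons; apply: finitely_spanned_linear.
have [/andP[/eqP e1 /eqP e2]|unbal] := boolP (balanced m); last first.
  by rewrite HP0_unbalanced //; apply: finitely_spanned0.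
rewrite [m]mon4K -e1 -e2 class_scaled; apply: finitely_spannedZ.
move: (m ix1) (m ix2) => j k {m e1 e2}.
set S := scaled_class _.
have S_boundary v : ~~ nonneg_pt v -> S v = 0.
  by rewrite /S /scaled_class => /negbTE ->.
have S_rel := HP0_relation G_group G_diag.
have [simp|nsimp] := pselect (simple_components V1 V2
    (component (Gr := Gamma V1 V2) (nat_point j k))); last first.
  rewrite (nonsimple_zero LB V1E V2E S_boundary S_rel nsimp).
  exact: finitely_spanned0.
pose D : simple_components V1 V2 :=
  exist (fun D => D \in simple_components V1 V2) _ (mem_set simp).
(* Moving along the component replaces e(j,k) by a multiple of e at the chosen vertex. *)
have [c _ ->] := component_scale V1E V2E S_boundary S_rel (chosen_in D).
rewrite /S /scaled_class chosen_ge0; do 2!apply: finitely_spannedZ.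
exact: (@finitely_spanned1 _ _ _ (fun D : simple_components V1 V2 =>
    HP0_class (invariants G) (vertex_monomial R (chosen D))) D).
Qed.
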